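(* There is no regular graph of degree $d\ge3$, diameter $4$ and cyclic defect, nor any regular graph of odd degree $d\ge3$, girth $9$ and cyclic excess.
   Context: For an integer $d\ge 1$ define polynomials $G_{d,m}(x)$ by $G_{d,0}(x)=1$, $G_{d,1}(x)=x+1$, and $G_{d,m+1}(x)=xG_{d,m}(x)-(d-1)G_{d,m-1}(x)$ for $m\ge1$. Let $J_n$ be the $n\times n$ all-ones matrix. For a graph on $n\ge3$ vertices, a cycle matrix is the adjacency matrix $B$ of an $n$-cycle on the same vertex set (i.e., for some ordering $v_1,\dots,v_n$ of the vertices, $B_{ij}=1$ iff $v_i,v_j$ are cyclically consecutive, and $0$ otherwise); this cycle need not consist of edges of the graph. A graph $\Gamma$ of order $n$ with adjacency matrix $A$ is a graph of degree $d$, diameter $D$ and cyclic defect if $\Gamma$ is $d$-regular with $d\ge3$, has diameter $D\ge2$, and $G_{d,D}(A)=J_n+B$ for some cycle matrix $B$. It is a graph of degree $d$, girth $g$ and cyclic excess if $\Gamma$ is $d$-regular with $d\ge3$, has odd girth $g\ge5$, and $G_{d,\lfloor g/2\rfloor}(A)=J_n-B$ for some cycle matrix $B$. *)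

(* Defs.v *)
From mathcomp Require Import all_boot all_order all_algebra perm.

Set Implicit Arguments.
Unset Strict Implicit.
Unset Printing Implicit Defensive.

Import GRing.Theory.

Local Open Scope ring_scope.

Record sgraph (V : finType) := SGraph {
  adj :> rel V;
  adj_sym : symmetric adj;
  adj_irrefl : irreflexive adj
}.

Definition regular (V : finType) (G : sgraph V) (d : nat) : Prop :=
  forall x : V, #|[set y | adj G x y]| = d.

Definition walk (V : finType) (G : sgraph V) (x y : V) (k : nat) : Prop :=
  exists p : seq V, [/\ size p = k, path (adj G) x p & last x p = y].

Definition is_dist (V : finType) (G : sgraph V) (x y : V) (k : nat) : Prop :=
  walk G x y k /\ forall l : nat, walk G x y l -> (k <= l)%N.

(* Connectedness is included, since every distance must exist. *)
Definition is_diameter (V : finType) (G : sgraph V) (D : nat) : Prop :=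
  (forall x y : V, exists2 k : nat, is_dist G x y k & (k <= D)%N) /\
  (exists x y : V, is_dist G x y D).

(* [ucycle] also accepts the empty sequence and, for an edge xy, the sequence
   [:: x; y]; the size condition keeps the genuine cycles. *)
Definition graph_cycle (V : finType) (G : sgraph V) (c : seq V) : Prop :=
  (3 <= size c)%N /\ ucycle (adj G) c.

Definition is_girth (V : finType) (G : sgraph V) (g : nat) : Prop :=
  (exists2 c : seq V, graph_cycle G c & size c = g) /\
  (forall c : seq V, graph_cycle G c -> (g <= size c)%N).

Definition adj_mx (n : nat) (G : sgraph 'I_n) : 'M[int]_n :=
  \matrix_(i, j) (adj G i j)%:R.

Fixpoint Gpoly (d m : nat) : {poly int} :=
  match m with
  | 0 => 1
  | m1.+1 =>
    match m1 with
    | 0 => 'X + 1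
    | m2.+1 => 'X * Gpoly d m1 - (d%:R - 1) *: Gpoly d m2
    end
  end.

(* The permutation v is the ordering of the vertices; [ordS] is the cyclic
   successor on 'I_n. *)
Definition is_cycle_mx (n : nat) (B : 'M[int]_n) : Prop :=
  (3 <= n)%N /\
  exists v : {perm 'I_n}, forall i j : 'I_n,
    B (v i) (v j) = ((j == ordS i) || (i == ordS j))%:R.

(* The vertex set is 'I_n.+1 because [horner_mx] requires a nonempty matrix;
   the empty graph has no cycle matrix anyway. *)
Definition cyclic_defect (n : nat) (G : sgraph 'I_n.+1) (d D : nat) : Prop :=
  [/\ (3 <= d)%N, regular G d, (2 <= D)%N, is_diameter G D &
    exists2 B : 'M[int]_n.+1, is_cycle_mx B &
      horner_mx (adj_mx G) (Gpoly d D) = const_mx 1 + B].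

Definition cyclic_excess (n : nat) (G : sgraph 'I_n.+1) (d g : nat) : Prop :=
  [/\ (3 <= d)%N, regular G d, odd g && (5 <= g)%N, is_girth G g &
    exists2 B : 'M[int]_n.+1, is_cycle_mx B &
      horner_mx (adj_mx G) (Gpoly d g./2) = const_mx 1 - B].

(* Main.v *)
(** The all-ones matrix commutes with the adjacency matrix [A] of a regular
    graph, hence so does the cycle matrix [B].  Index the vertices by [Z/N] along
    the cycle and write [a i j] for the entries of [A]: commutation is the
    discrete wave equation [a(i+1,j) + a(i-1,j) = a(i,j+1) + a(i,j-1)], whose
    solutions are sums [f(i+j) + g(i-j)].  The zero diagonal makes [a i j] depend
    only on [i-j] when this difference is even; since the entries are 0 or 1, for
    odd differences it depends on [i-j] alone or on [i+j] alone.  So the graph is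
    invariant either under all rotations, or under even rotations and reflections.
    With degree at least 3 this forces a 4-cycle or a 6-cycle: two commuting
    moves give the former, three reflections the latter.  This contradicts girth
    at least 7.  For cyclic defect, [G_D(A)] counts the non-backtracking walks of
    length at most [D], and the short cycle provides two such walks, both from a
    vertex to itself or both between two vertices that are not neighbours in the
    cycle. *)

Require Import Defs.
From mathcomp Require Import all_boot all_order all_algebra perm.
From mathcomp Require Import ring zify.

Set Implicit Arguments.
Unset Strict Implicit.
Unset Printing Implicit Defensive.

Import GRing.Theory Num.Theory Order.TTheory.

Local Open Scope ring_scope.

Lemma nat_of_bool_inj : injective nat_of_bool.
Proof. by do 2![case]. Qed.

(** * Zero-one solutions of the wave equation on Z/N *)

Section Wave.

Variables (n : nat) (a : rel 'I_n.+3).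
Implicit Types i j k m x y s : 'I_n.+3.

Hypothesis wave : forall i j,
  (a (i + 1)%R j + a (i - 1)%R j = a i (j + 1)%R + a i (j - 1)%R)%N.
Hypothesis a_sym : symmetric a.
Hypothesis a_irr : irreflexive a.

(** The wave equation says that [a (i + 1) j - a i (j + 1)] takes equal values at (i, j) and (i - 1,
    j - 1); iterate. Sums replace differences since the values lie in [nat]. *)
Lemma wave_step i j m :
  (a (i + 1)%R j + a (i + m)%R (j + 1 + m)%R
   = a i (j + 1)%R + a (i + 1 + m)%R (j + m)%R)%N.
Proof.
rewrite -(natr_Zp m); elim: (m : nat) => [|k IH]; first by rewrite !addr0 addnC.
have := wave (i + k%:R + 1) (j + k%:R + 1).
have -> : i + k%:R + 1 - 1 = i + k%:R by ring.
have -> : j + k%:R + 1 - 1 = j + k%:R by ring.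
have -> : i + k.+1%:R = i + k%:R + 1 by rewrite -natr1; ring.
have -> : j + k.+1%:R = j + k%:R + 1 by rewrite -natr1; ring.
have -> : i + 1 + k.+1%:R = i + k%:R + 1 + 1 by rewrite -natr1; ring.
have -> : j + 1 + k.+1%:R = j + k%:R + 1 + 1 by rewrite -natr1; ring.
move: IH.
have -> : i + 1 + k%:R = i + k%:R + 1 by ring.
have -> : j + 1 + k%:R = j + k%:R + 1 by ring.
by do !move: (nat_of_bool _) => ?; lia.
Qed.

(** Summing [wave_step] along an antidiagonal gives a rectangle rule in the two diagonal directions,
    which replaces the decomposition f(i+j) + g(i-j). *)
Lemma wave_shift i j k m :
  (a (i + k)%R (j - k)%R + a (i + m)%R (j + m)%R
   = a (i + k + m)%R (j - k + m)%R + a i j)%N.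
Proof.
rewrite -(natr_Zp k); elim: (k : nat) => [|l IH].
  by rewrite subr0 !addr0 addnC.
have := wave_step (i + l%:R) (j - l%:R - 1) m.
have -> : j - l%:R - 1 + 1 = j - l%:R by ring.
have -> : i + l.+1%:R = i + l%:R + 1 by rewrite -natr1; ring.
have -> : j - l.+1%:R = j - l%:R - 1 by rewrite -natr1; ring.
by move: IH; do !move: (nat_of_bool _) => ?; lia.
Qed.

(** In the rectangle based at (y + k, y + k), two corners lie on the main diagonal, where [a]
    vanishes. *)
Lemma even_circulant x y k m : x = y + k + k -> a (x + m) (y + m) = a x y.
Proof.
move=> ->; have := wave_shift (y + k) (y + k) k m.
rewrite !a_irr addrK => e; apply: nat_of_bool_inj.
by move: e; rewrite !addn0 => ->.
Qed.

(** Even means a double in Z/N, so for odd N both alternatives hold for every [x]. *)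
Lemma even_or_odd x : exists k, x = k + k \/ x = k + k + 1.
Proof.
have [h] : exists h : 'I_n.+3, (odd x)%:R + (h + h) = x.
  exists ((x : nat)./2)%:R.
  by rewrite -!natrD addnn odd_double_half natr_Zp.
case: (odd x) => <-; exists h; first by right; rewrite addrC.
by left; rewrite add0r.
Qed.

Definition neighbour3 x := exists y1 y2 y3,
  [/\ a x y1, a x y2 & a x y3] /\ [/\ y1 != y2, y2 != y3 & y1 != y3].

Definition has_4cycle := exists x0 x1 x2 x3,
  [/\ a x0 x1, a x1 x2, a x2 x3 & a x3 x0] /\ (x0 != x2 /\ x1 != x3).

Lemma circulant_4cycle : neighbour3 0 ->
  (forall x y m, a (x + m) (y + m) = a x y) -> has_4cycle.
Proof.
move=> [s [y2 [y3 [[a1 a2 a3] [n12 n23 n13]]]]] circ.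
(* At most one of [y2] and [y3] is [- s]; avoiding it keeps [0] and [s + t] distinct. *)
have [t [at_ nst nst0]] : exists t, [/\ a 0 t, s != t & s + t != 0].
  case: (eqVneq (s + y2) 0) => [e|ne]; last by exists y2.
  exists y3; split=> //; apply: contra n23 => /eqP e3.
  by apply/eqP/(@addrI _ s); rewrite e e3.
exists 0, s, (s + t), t; split; last by rewrite eq_sym.
split=> //; last by rewrite a_sym.
- by rewrite -[X in a X _](add0r s) (addrC s) circ.
- by rewrite a_sym -[X in a X _](add0r t) circ.
Qed.

Lemma avoid_double s : exists x, x + x != s.
Proof.
case: (eqVneq (0 + 0) s) => [<-|]; last by exists 0.
by exists 1.
Qed.

(** The last conjunct makes the entry of the cycle matrix at [x0], [x2] zero, so that in the defect
    case two walks between them are one too many. *)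
Definition has_6cycle := exists x0 x1 x2 x3 x4 x5,
  [/\ [/\ a x0 x1, a x1 x2 & a x2 x3], [/\ a x3 x4, a x4 x5 & a x5 x0],
      uniq [:: x0; x1; x2; x3; x4; x5] & (x2 != x0 + 1) && (x0 != x2 + 1)].

(* Reflections satisfy s1 s2 s3 s1 s2 s3 = 1, which closes up after six steps. *)
Lemma reflections_6cycle s1 s2 s3 :
  (forall x, [/\ a x (s1 - x), a x (s2 - x) & a x (s3 - x)]) ->
  [/\ s1 != s2, s2 != s3 & s1 != s3] ->
  (s2 != s1 + 1) && (s1 != s2 + 1) -> has_6cycle.
Proof.
move=> refl [n12 n23 n13] /andP[d1 d2].
have neqB (x y z t : 'I_n.+3) : z != t -> x - y = z - t -> x != y.
  by rewrite -subr_eq0 -[x == y]subr_eq0 => + ->.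
have neqa z t : a z t -> z != t by apply: contraTneq => ->; rewrite a_irr.
have adjE s z y : (forall x, a x (s - x)) -> z + y = s -> a z y.
  by move=> h e; have := h z; rewrite -e addrC addKr.
have r1 x : a x (s1 - x) by case: (refl x).
have r2 x : a x (s2 - x) by case: (refl x).
have r3 x : a x (s3 - x) by case: (refl x).
(* Each of the three pairs of opposite vertices coincides exactly when [x + x = s1 + s3 - s2].
   Vertices two steps apart differ by a difference of two of the [s1], [s2], [s3]. *)
have [x xN] := avoid_double (s1 + s3 - s2).
exists x, (s1 - x), (x + s2 - s1), (s1 + s3 - s2 - x), (x + s2 - s3), (s3 - x).
have a01 : a x (s1 - x) by [].
have a12 : a (s1 - x) (x + s2 - s1) by apply: adjE r2 _; ring.
have a23 : a (x + s2 - s1) (s1 + s3 - s2 - x) by apply: adjE r3 _; ring.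
have a34 : a (s1 + s3 - s2 - x) (x + s2 - s3) by apply: adjE r1 _; ring.
have a45 : a (x + s2 - s3) (s3 - x) by apply: adjE r2 _; ring.
have a50 : a (s3 - x) x by apply: adjE r3 _; ring.
split=> //; last first.
  apply/andP; split.
    by apply: (neqB _ _ _ _ d1); ring.
  by apply: (neqB _ _ _ _ d2); ring.
have n02 : x != x + s2 - s1 by apply: (neqB _ _ _ _ n12); ring.
have n03 : x != s1 + s3 - s2 - x by apply: (neqB _ _ _ _ xN); ring.
have n04 : x != x + s2 - s3.
  by rewrite eq_sym; apply: (neqB _ _ _ _ n23); ring.
have n13' : s1 - x != s1 + s3 - s2 - x by apply: (neqB _ _ _ _ n23); ring.
have n14 : s1 - x != x + s2 - s3.
  by rewrite eq_sym; apply: (neqB _ _ _ _ xN); ring.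
have n15 : s1 - x != s3 - x by apply: (neqB _ _ _ _ n13); ring.
have n24 : x + s2 - s1 != x + s2 - s3.
  by rewrite eq_sym; apply: (neqB _ _ _ _ n13); ring.
have n25 : x + s2 - s1 != s3 - x by apply: (neqB _ _ _ _ xN); ring.
have n35 : s1 + s3 - s2 - x != s3 - x by apply: (neqB _ _ _ _ n12); ring.
rewrite /= !inE !negb_or n02 n03 n04 n13' n14 n15 n24 n25 n35.
by rewrite (neqa _ _ a01) (neqa _ _ a12) (neqa _ _ a23) (neqa _ _ a34)
  (neqa _ _ a45) neqa.
Qed.

(** The split is on whether the entries [a (i + 1) i] all agree. If so, odd differences are
    circulant too; if not, [a] is constant on the antidiagonal through each of these entries. *)
Lemma wave_short_cycle : neighbour3 0 -> has_4cycle \/ has_6cycle.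
Proof.
move=> nb0; have [/forallP unif|] := boolP [forall i, a (i + 1) i == a 1 0].
  left; apply: circulant_4cycle => // x y m.
  have [k [e|e]] := even_or_odd (x - y).
    by apply: (@even_circulant _ _ k); rewrite -(subrK y x) e; ring.
  have -> : x = y + k + 1 + k by rewrite -(subrK y x) e; ring.
  have := wave_shift (y + k + 1) (y + k) k m; rewrite addrK.
  have -> : y + k + 1 + m = y + k + m + 1 by ring.
  rewrite !(eqP (unif _)) => e'; apply/esym/nat_of_bool_inj.
  by move: e'; do !move: (nat_of_bool _) => ?; lia.
rewrite negb_forall => /existsP[i1 ne1].
(* With p and p' the distinct entries at [i] and [i'], the rectangle rule reads u + p' = u' + p. All
   values being 0 or 1, this forces u = p. *)
have dih i k : a (i + 1 + k) (i - k) = a (i + 1) i.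
  have [i' ne'] : exists i', a (i' + 1) i' != a (i + 1) i.
    case: (eqVneq (a (i + 1) i) (a 1 0)) => [->|ne]; first by exists i1.
    by exists 0; rewrite add0r eq_sym.
  have := wave_shift (i + 1) i k (i' - i).
  have -> : i + 1 + (i' - i) = i' + 1 by ring.
  have -> : i + (i' - i) = i' by ring.
  by move: ne'; do 4!case: (a _ _).
have refl x y k z : x - y = k + k + 1 -> a x y -> a z (x + y - z).
  move=> e; have -> : x = y + k + 1 + k by rewrite -(subrK y x) e; ring.
  have := dih (y + k) k; rewrite addrK => ->.
  rewrite -(dih _ (z - (y + k + 1))).
  have -> : y + k + 1 + (z - (y + k + 1)) = z by ring.
  by have -> : y + k - (z - (y + k + 1)) = y + k + 1 + k + y - z by ring.
have [i0 a0] : exists i0, a (i0 + 1) i0.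
  have [] := boolP (a 1 0) => [?|n10]; first by exists 0; rewrite add0r.
  by exists i1; move: ne1; rewrite (negPf n10); case: (a _ _).
(* Translation by [k + k] and reflection in [i0 + i0 + 1] both send every vertex to a neighbour.
   Alternating them closes after four steps, and [x] is chosen so that opposite vertices differ. *)
have [/existsP[k ak]|] := boolP [exists k, a (k + k) 0].
  have rot x : a (x + k + k) x.
    have := @even_circulant (0 + k + k) 0 k x erefl; rewrite !add0r ak.
    by have -> : x + k + k = k + k + x by ring.
  have ref z : a z (i0 + i0 + 1 - z).
    have := refl (i0 + 1) i0 0 z; rewrite [i0 + 1 + i0]addrAC; apply=> //; ring.
  have [x xN] := avoid_double (i0 + i0 + 1 - k - k).
  left; exists x, (x + k + k), (i0 + i0 + 1 - x - k - k), (i0 + i0 + 1 - x).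
  split; [split|split].
  - by rewrite a_sym.
  - have := ref (x + k + k).
    by have -> : i0 + i0 + 1 - (x + k + k) = i0 + i0 + 1 - x - k - k by ring.
  - by have := rot (i0 + i0 + 1 - x - k - k); rewrite !subrK a_sym.
  - by rewrite a_sym.
  - by apply: contra xN => /eqP {1}->; apply/eqP; ring.
  - apply: contra xN => /eqP e; apply/eqP.
    by rewrite -[x in x + _](addrK k) -[x + k](addrK k) e; ring.
rewrite negb_exists => /forallP noeven.
have odd_nb y : a 0 y -> exists k, y = k + k + 1.
  move=> a0y; have [k [e|]] := even_or_odd y; last by exists k.
  by have := noeven k; rewrite -e a_sym a0y.
(* Otherwise the edge from [i0 + 1] to [i0] would have an even difference. Consequently two odd
   neighbours of [0] never differ by 1. *)
have nodouble k : k + k != 1.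
  apply/eqP => e; have := noeven k; rewrite -(even_circulant i0 (k := k)).
    by rewrite add0r e addrC a0.
  by rewrite add0r.
have [y1 [y2 [y3 [[a1 a2 a3] neq]]]] := nb0.
have [[k1 e1] [k2 e2] [k3 e3]] := And3 (odd_nb _ a1) (odd_nb _ a2) (odd_nb _ a3).
right; apply: (@reflections_6cycle y1 y2 y3) => //.
  move=> x; split; [rewrite -[y1]addr0|rewrite -[y2]addr0|rewrite -[y3]addr0].
  - by apply: (refl _ _ k1); rewrite ?subr0 // a_sym.
  - by apply: (refl _ _ k2); rewrite ?subr0 // a_sym.
  - by apply: (refl _ _ k3); rewrite ?subr0 // a_sym.
rewrite e1 e2; apply/andP; split.
  apply: contra (nodouble (k2 - k1)) => /eqP/addIr e; apply/eqP.
  by rewrite addrACA e; ring.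
apply: contra (nodouble (k1 - k2)) => /eqP/addIr e; apply/eqP.
by rewrite addrACA e; ring.
Qed.

End Wave.

(** * Counting non-backtracking walks *)

Section Walks.

Variables (n : nat) (G : sgraph 'I_n.+1).
Implicit Types (x y z w : 'I_n.+1) (p : seq 'I_n.+1).

(* Number of non-backtracking walks of length [m] from [x] to [y] whose first
   step does not go to [z]. *)
Fixpoint nbwalks_from m z x y : int :=
  if m is m'.+1 then \sum_(w | adj G x w && (w != z)) nbwalks_from m' x w y
  else (x == y)%:R.

Definition nbwalks m x y : int :=
  if m is m'.+1 then \sum_(w | adj G x w) nbwalks_from m' x w y
  else (x == y)%:R.

Fixpoint nbpath z x p :=
  if p is w :: p' then [&& adj G x w, w != z & nbpath x w p'] else true.

Lemma nbwalks_from_ge0 m z x y : 0 <= nbwalks_from m z x y.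
Proof.
elim: m z x => [|m IH] z x /=; first exact: ler0n.
by apply: sumr_ge0 => w _; apply: IH.
Qed.

Lemma nbwalks_ge0 m x y : 0 <= nbwalks m x y.
Proof.
case: m => [|m] /=; first exact: ler0n.
by apply: sumr_ge0 => w _; apply: nbwalks_from_ge0.
Qed.

Lemma nbwalks_from_gt0 z x p :
  nbpath z x p -> 0 < nbwalks_from (size p) z x (last x p).
Proof.
elim: p z x => [|w p IH] z x /=; first by rewrite eqxx.
case/and3P=> xw wz /IH pos; rewrite (bigD1 w) ?xw //=.
apply: ltr_wpDr pos; apply: sumr_ge0 => *; exact: nbwalks_from_ge0.
Qed.

Lemma nbwalks_gt0 x w p :
  adj G x w -> nbpath x w p -> 0 < nbwalks (size p).+1 x (last w p).
Proof.
move=> xw /nbwalks_from_gt0 pos; rewrite /= (bigD1 w) //=.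
apply: ltr_wpDr pos; apply: sumr_ge0 => *; exact: nbwalks_from_ge0.
Qed.

(** The discarded walks step to [z] and then must not return to [x]. *)
Lemma nbwalks_fromS m z x y : adj G x z ->
  nbwalks_from m.+1 z x y = nbwalks m.+1 x y - nbwalks_from m x z y.
Proof. by move=> xz; rewrite /= [in RHS](bigD1 z) //= addrAC subrr add0r. Qed.

Variable d : nat.
Hypothesis regG : regular G d.

Lemma sum_adj_const x (c : int) : \sum_(w | adj G x w) c = d%:R * c.
Proof.
rewrite sumr_const -(regG x) mulr_natl; congr (_ *+ _).
by apply: eq_card => w; rewrite !inE.
Qed.

Lemma nbwalksSS m x y :
  nbwalks m.+2 x y = \sum_(w | adj G x w) nbwalks m.+1 w y
    - \sum_(w | adj G x w) nbwalks_from m w x y.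
Proof.
rewrite -sumrB; apply: eq_bigr => w xw.
by rewrite nbwalks_fromS // adj_sym.
Qed.

Lemma nbwalks2 x y :
  nbwalks 2 x y = \sum_(w | adj G x w) nbwalks 1 w y - d%:R * nbwalks 0 x y.
Proof. by rewrite nbwalksSS sum_adj_const. Qed.

(** A walk from [x] is subtracted once for each neighbour of [x] other than its first step, hence d
    - 1 times. A walk of length 0 has no first step, whence the coefficient d in [nbwalks2]. *)
Lemma nbwalksSSS m x y :
  nbwalks m.+3 x y = \sum_(w | adj G x w) nbwalks m.+2 w y
    - (d%:R - 1) * nbwalks m.+1 x y.
Proof.
rewrite nbwalksSS; congr (_ - _).
rewrite (eq_bigr (fun w => nbwalks m.+1 x y - nbwalks_from m x w y)).
  by rewrite sumrB sum_adj_const mulrBl mul1r.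
by move=> w xw; rewrite nbwalks_fromS.
Qed.

Definition nbwalk_mx m : 'M[int]_n.+1 := \matrix_(x, y) nbwalks m x y.

Lemma adj_mulmxE (M : 'M[int]_n.+1) x y :
  (adj_mx G * M) x y = \sum_(w | adj G x w) M w y.
Proof.
rewrite mxE [RHS]big_mkcond; apply: eq_bigr => w _.
by rewrite mxE; case: (adj G x w); rewrite ?mul1r ?mul0r.
Qed.

Lemma nbwalk_mx0 : nbwalk_mx 0 = 1.
Proof. by apply/matrixP => x y; rewrite !mxE. Qed.

Lemma nbwalk_mx1 : nbwalk_mx 1 = adj_mx G.
Proof.
apply/matrixP => x y; rewrite !mxE /=.
rewrite big_mkcond (bigD1 y) //= eqxx big1 ?addr0; first by case: (adj G x y).
by move=> w /negPf ->; case: (adj G x w).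
Qed.

Lemma nbwalk_mx2 :
  nbwalk_mx 2 = adj_mx G * nbwalk_mx 1 - d%:R *: nbwalk_mx 0.
Proof.
apply/matrixP => x y; rewrite [LHS]mxE [RHS]mxE adj_mulmxE nbwalks2.
by rewrite !mxE; congr (_ - _); apply: eq_bigr => w _; rewrite mxE.
Qed.

Lemma nbwalk_mxSSS m :
  nbwalk_mx m.+3 = adj_mx G * nbwalk_mx m.+2 - (d%:R - 1) *: nbwalk_mx m.+1.
Proof.
apply/matrixP => x y; rewrite [LHS]mxE [RHS]mxE adj_mulmxE nbwalksSSS.
by rewrite !mxE; congr (_ - _); apply: eq_bigr => w _; rewrite mxE.
Qed.

(** Passing to partial sums makes the recurrence uniform: the identity summand turns the exceptional
    d into d - 1. *)
Lemma sum_nbwalk_mxSS m :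
  \sum_(k < m.+3) nbwalk_mx k = adj_mx G * (\sum_(k < m.+2) nbwalk_mx k)
    - (d%:R - 1) *: \sum_(k < m.+1) nbwalk_mx k.
Proof.
elim: m => [|m IH].
  rewrite !big_ord_recr !big_ord0 /= !add0r nbwalk_mx2 nbwalk_mx0 nbwalk_mx1.
  by rewrite mulrDr mulr1 scalerBl scale1r opprB [1 + _]addrC -!addrA [1 + _]addrCA.
rewrite [LHS]big_ord_recr /= [X in X + _ = _]IH nbwalk_mxSSS.
rewrite [X in _ = _ * X - _]big_ord_recr [X in _ = _ - _ *: X]big_ord_recr /=.
by rewrite [in RHS]mulrDr [in RHS]scalerDr opprD addrACA.
Qed.

Lemma horner_Gpoly m :
  horner_mx (adj_mx G) (Gpoly d m) = \sum_(k < m.+1) nbwalk_mx k.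
Proof.
elim/ltn_ind: m => -[|[|m]] IH.
- by rewrite big_ord_recr big_ord0 /= add0r nbwalk_mx0 rmorph1.
- rewrite !big_ord_recr big_ord0 /= add0r nbwalk_mx0 nbwalk_mx1.
  by rewrite rmorphD rmorph1 /= horner_mx_X addrC.
- rewrite sum_nbwalk_mxSS -!IH //.
  by rewrite -[Gpoly d m.+2]/('X * Gpoly d m.+1 - (d%:R - 1) *: Gpoly d m)
    rmorphB rmorphM /= horner_mx_X horner_mxZ.
Qed.

Lemma nbwalks_add_le_Gpoly k l m x y : (k < l <= m)%N ->
  nbwalks k x y + nbwalks l x y <= horner_mx (adj_mx G) (Gpoly d m) x y.
Proof.
case/andP=> ltkl lelm; have ltkm : (k < m.+1)%N by lia.
rewrite horner_Gpoly summxE (bigD1 (Ordinal ltkm)) //=.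
rewrite (bigD1 (Ordinal (lelm : l < m.+1)%N)) /=; last by rewrite -val_eqE /=; lia.
rewrite !mxE addrA lerDl; apply: sumr_ge0 => i _.
by rewrite mxE nbwalks_ge0.
Qed.

End Walks.

(** * From commutation with the cycle matrix to short cycles *)

Lemma ordS_addr1 n (i : 'I_n.+3) : ordS i = i + 1.
Proof. by apply: val_inj => /=; rewrite modnDmr addn1. Qed.

Lemma sum_cycle_neighbours n (f : 'I_n.+3 -> int) j :
  \sum_k f k * ((j == ordS k) || (k == ordS j))%:R = f (j - 1) + f (j + 1).
Proof.
(* There are at least three vertices, so 2 is nonzero. *)
have neq1 : (j - 1 == j + 1) = false.
  by apply/eqP => /addrI /eqP; rewrite eq_sym -subr_eq0 opprK.
rewrite (bigD1 (j - 1)) //= (bigD1 (j + 1)) /=; last by rewrite eq_sym neq1.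
rewrite !ordS_addr1 subrK !eqxx orbT !mulr1 big1 ?addr0 // => k /andP[n1 n2].
by rewrite !ordS_addr1 (negPf n2) -subr_eq eq_sym (negPf n1) mulr0.
Qed.

Lemma regular_comm_const n (G : sgraph 'I_n) d : regular G d ->
  comm_mx (adj_mx G) (const_mx 1).
Proof.
move=> regG; have row x : \sum_y adj_mx G x y = d%:R.
  under eq_bigr do rewrite mxE.
  by rewrite -natr_sum -big_mkcond /= sum1dep_card regG.
apply/matrixP => x y; rewrite !mxE.
under eq_bigr do rewrite [const_mx _ _ _]mxE mulr1.
under [RHS]eq_bigr do rewrite [const_mx _ _ _]mxE mul1r.
rewrite row -(row y); apply: eq_bigr => z _.
by rewrite !mxE adj_sym.
Qed.

(** At the entry (v i, v j), the product A B sums over the cycle neighbours of [j], and B A over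
    those of [i]. *)
Lemma comm_cycle_wave n (G : sgraph 'I_n.+3) (B : 'M_n.+3) (v : {perm 'I_n.+3}) :
  (forall i j, B (v i) (v j) = ((j == ordS i) || (i == ordS j))%:R) ->
  comm_mx (adj_mx G) B ->
  forall i j (a := fun i j => adj G (v i) (v j)),
  (a (i + 1)%R j + a (i - 1)%R j = a i (j + 1)%R + a i (j - 1)%R)%N.
Proof.
move=> Bv comAB i j a; have /matrixP/(_ (v i) (v j)) := comAB.
rewrite !mxE [LHS](reindex_inj (@perm_inj _ v)) /=.
rewrite [RHS](reindex_inj (@perm_inj _ v)) /=.
under eq_bigr do rewrite mxE Bv.
under [RHS]eq_bigr do rewrite mxE Bv mulrC orbC.
rewrite (sum_cycle_neighbours (fun k => (a i k)%:R)).
rewrite (sum_cycle_neighbours (fun k => (a k j)%:R)) -!natrD => /eqP.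
by rewrite eqr_nat addnC => /eqP ->; rewrite addnC.
Qed.

Lemma comm_cycle_short_cycle n (G : sgraph 'I_n.+3) d (B : 'M_n.+3)
    (v : {perm 'I_n.+3}) :
  (forall i j, B (v i) (v j) = ((j == ordS i) || (i == ordS j))%:R) ->
  comm_mx (adj_mx G) B -> regular G d -> (3 <= d)%N ->
  let a := fun i j => adj G (v i) (v j) in has_4cycle a \/ has_6cycle a.
Proof.
move=> Bv comAB regG d3 a; apply: wave_short_cycle.
- exact: comm_cycle_wave Bv comAB.
- by move=> i j; rewrite /a adj_sym.
- by move=> i; rewrite /a adj_irrefl.
rewrite -(regG (v 0)) in d3; have [y1 [y2 [y3 []]]] := card_gt2P d3.
rewrite !inE => -[a1 a2 a3] [n12 n23 n31].
exists (v^-1 y1)%g, (v^-1 y2)%g, (v^-1 y3)%g; rewrite /a !permKV.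
by rewrite !(inj_eq perm_inj) (eq_sym y1 y3).
Qed.

(** * Contradictions with walk counts and with girth *)

Theorem no_cyclic_defect d n (G : sgraph 'I_n.+1) D :
  (4 <= D)%N -> ~ cyclic_defect G d D.
Proof.
move=> D4 [d3 regG _ _ [B [n3 [v Bv]] GB]].
case: n n3 G regG B v Bv GB => [|[|n]] // _ G regG B v Bv GB.
have comAB : comm_mx (adj_mx G) B.
  have -> : B = horner_mx (adj_mx G) (Gpoly d D) - const_mx 1.
    by rewrite GB addrC addKr.
  apply: comm_mxB; last exact: regular_comm_const regG.
  exact: comm_mx_horner.
have GBv i j : horner_mx (adj_mx G) (Gpoly d D) (v i) (v j)
    = 1 + ((j == ordS i) || (i == ordS j))%:R by rewrite GB mxE Bv mxE.
have [[x0 [x1 [x2 [x3 [[a01 a12 a23 a30] [n02 n13]]]]]]|] :=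
  comm_cycle_short_cycle Bv comAB regG d3.
  (* The 4-cycle and the empty walk both count towards a diagonal entry of J + B, which is 1. *)
  have pos : 0 < nbwalks G 4 (v x0) (v x0).
    apply: (@nbwalks_gt0 _ G (v x0) (v x1) [:: v x2; v x3; v x0]) => //=.
    by rewrite a12 a23 a30 !(inj_eq perm_inj) (eq_sym x2) n02 (eq_sym x3) n13.
  have := @nbwalks_add_le_Gpoly _ G d regG 0 4 D (v x0) (v x0) D4.
  have neq1 : (x0 == x0 + 1) = false.
    by rewrite -[X in X == _]addr0 (inj_eq (@addrI _ x0)).
  rewrite GBv orbb ordS_addr1 neq1 [nbwalks G 0 _ _]/= eqxx; lia.
move=> [x0 [x1 [x2 [x3 [x4 [x5 [[a01 a12 a23] [a34 a45 a50] u6 nB]]]]]]].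
have /andP[d1 d2] := nB.
(* The two ways round the hexagon from [x0] to [x2] have lengths 2 and 4. *)
have pos2 : 0 < nbwalks G 2 (v x0) (v x2).
  apply: (@nbwalks_gt0 _ G (v x0) (v x1) [:: v x2]) => //=.
  rewrite a12 (inj_eq perm_inj) (eq_sym x2).
  by move: u6; rewrite /= !inE !negb_or => /andP[/and5P[_ ->]].
have pos4 : 0 < nbwalks G 4 (v x0) (v x2).
  apply: (@nbwalks_gt0 _ G (v x0) (v x5) [:: v x4; v x3; v x2]) => /=.
    by rewrite adj_sym.
  rewrite (adj_sym G _ (v x4)) (adj_sym G _ (v x3)) (adj_sym G _ (v x2)).
  rewrite a45 a34 a23 !(inj_eq perm_inj) (eq_sym x4).
  move: u6; rewrite /= !inE !negb_or => /and5P[].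
  by move=> /and5P[_ _ _ -> _] _ /and3P[_ -> _] /andP[_ ->].
have := @nbwalks_add_le_Gpoly _ G d regG 2 4 D (v x0) (v x2) D4.
rewrite GBv !ordS_addr1 (negPf d1) (negPf d2); lia.
Qed.

Theorem no_cyclic_excess d n (G : sgraph 'I_n.+1) g :
  (7 <= g)%N -> ~ cyclic_excess G d g.
Proof.
move=> g7 [d3 regG _ [_ girth] [B [n3 [v Bv]] GB]].
case: n n3 G regG girth B v Bv GB => [|[|n]] // _ G regG girth B v Bv GB.
have comAB : comm_mx (adj_mx G) B.
  have -> : B = const_mx 1 - horner_mx (adj_mx G) (Gpoly d g./2).
    by rewrite GB opprB addrC subrK.
  apply: comm_mxB; first exact: regular_comm_const regG.
  exact: comm_mx_horner.
have no_cycle (c : seq 'I_n.+3) : (3 <= size c <= 6)%N -> uniq c ->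
    ~ cycle (adj G) (map v c).
  case/andP=> c3 c6 uc cyc.
  have /girth : graph_cycle G (map v c).
    split; first by rewrite size_map.
    by rewrite /ucycle /ucycleb cyc map_inj_uniq //; apply: perm_inj.
  by rewrite size_map; move: (size c) c6 => s; lia.
have irr x y : adj G (v x) (v y) -> x != y.
  by apply: contraTneq => ->; rewrite adj_irrefl.
have [[x0 [x1 [x2 [x3 [[a01 a12 a23 a30] [n02 n13]]]]]]|] :=
  comm_cycle_short_cycle Bv comAB regG d3.
  apply: (no_cycle [:: x0; x1; x2; x3]) => //=; last by rewrite a01 a12 a23 a30.
  rewrite !inE !negb_or n02 n13 (irr _ _ a01) (irr _ _ a12) (irr _ _ a23).
  by rewrite eq_sym (irr _ _ a30).
move=> [x0 [x1 [x2 [x3 [x4 [x5 [[a01 a12 a23] [a34 a45 a50] u6 _]]]]]]].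
by apply: (no_cycle _ _ u6) => //=; rewrite a01 a12 a23 a34 a45 a50.
Qed.

Local Close Scope ring_scope.

Theorem theorem1 :
  (forall (d n : nat) (G : sgraph 'I_n.+1),
     3 <= d -> ~ cyclic_defect G d 4) /\
  (forall (d n : nat) (G : sgraph 'I_n.+1),
     3 <= d -> odd d -> ~ cyclic_excess G d 9).
Proof.
split=> d n G _; first exact: no_cyclic_defect.
by move=> _; apply: no_cyclic_excess.
Qed.
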